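(* For every $\lambda\in\mathcal{O}$, the machine $\Phi$ applied to $\lambda$ terminates and outputs a partition $\Phi(\lambda)\in\mathcal{E}$ with the same size and color product as $\lambda$; the map $\Phi:\mathcal{O}\to\mathcal{E}$ is injective, and $\Psi(\Phi(\lambda))=\lambda$ for all $\lambda\in\mathcal{O}$.
   Context: Primary colors $a_1<\cdots<a_n$; secondary colors $a_ia_j$, $1\le i<j\le n$; total order $a_1a_2<\cdots<a_1a_n<a_1<a_2a_3<\cdots<a_2a_n<a_2<\cdots<a_{n-1}a_n<a_{n-1}<a_n$. A part $k_p$ has integer size $k$ and color $p$; $k_p+m=(k+m)_p$. $k_p\succ l_q$ iff $k-l\ge\chi(p\le q)$; $\succeq$ means $\succ$ or equal. A pair $(a_ka_l,a_ia_j)$ of secondary colors is special if $i<j<k<l$ or $k<i<j<l$. $\mathcal{P}$: primary-colored parts of positive size; $\mathcal{S}$: secondary-colored parts of size $\ge2$. $k_p\gg l_q$ iff $k_p\succeq(l+1)_q$ if $p$ or $q$ primary; $k_p\succ(l+1)_q$ if both secondary and not special; $k_p\succ l_q$ if $(p,q)$ special. $\mathcal{O}$: sequences $\lambda_1\succ\cdots\succ\lambda_t$ in $\mathcal{P}$; $\mathcal{E}$: sequences $\nu_1\gg\cdots\gg\nu_t$ in $\mathcal{P}\sqcup\mathcal{S}$. Halves: $\alpha((2k)_{a_ia_j})=k_{a_j}$, $\beta((2k)_{a_ia_j})=k_{a_i}$, $\alpha((2k+1)_{a_ia_j})=(k+1)_{a_i}$, $\beta((2k+1)_{a_ia_j})=k_{a_j}$.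 Machine $\Phi$ on a sequence $\lambda_1,\ldots,\lambda_t$: Step 1: take the smallest $i$ with $\lambda_i,\lambda_{i+1}\in\mathcal{P}$, $\lambda_i\succ\lambda_{i+1}$ and not $\lambda_i\gg\lambda_{i+1}$; if it exists, replace these two parts by the single part whose size is the sum of their sizes and whose secondary color is the product of their (distinct) colors, and go to Step 2; otherwise stop. Step 2: take the smallest $i$ with $(\lambda_i,\lambda_{i+1})\in\mathcal{P}\times\mathcal{S}$ and not $\lambda_i\gg\lambda_{i+1}$; if it exists, replace $(\lambda_i,\lambda_{i+1})$ by $(\lambda_{i+1}+1,\lambda_i-1)$ and redo Step 2; otherwise go to Step 1. Machine $\Psi$ on a sequence $\nu_1,\ldots,\nu_t$: Step 1: take the greatest $i$ with $\nu_i\in\mathcal{S}$; if none, stop. If $\nu_{i+1}$ exists, lies in $\mathcal{P}$ and $\beta(\nu_i)\not\succ\nu_{i+1}$, replace $(\nu_i,\nu_{i+1})$ by $(\nu_{i+1}+1,\nu_i-1)$ and redo Step 1; otherwise go to Step 2. Step 2: take the greatest $i$ with $\nu_i\in\mathcal{S}$ and replace $\nu_i$ by the two consecutive parts $\alpha(\nu_i),\beta(\nu_i)$; go to Step 1. *)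

(* Defs.v *)
From mathcomp Require Import all_boot all_order all_algebra.
From mathcomp Require Import zify.

Set Implicit Arguments.
Unset Strict Implicit.
Unset Printing Implicit Defensive.

Import Order.TTheory GRing.Theory Num.Theory.

Local Open Scope ring_scope.

(* The primary color a_(i+1) is i : 'I_n; the secondary color a_(i+1)a_(j+1)
   is the pair (i, j) with i < j. *)
Definition secondary (n : nat) := {p : 'I_n * 'I_n | (p.1 < p.2)%N}.
Definition color (n : nat) := ('I_n + secondary n)%type.

Definition is_primary (n : nat) (p : color n) : bool := if p is inl _ then true else false.
Definition is_secondary (n : nat) (p : color n) : bool := ~~ is_primary p.

(* The order a_1a_2 < ... < a_1a_n < a_1 < a_2a_3 < ... < a_(n-1) < a_n is the
   lexicographic order for the keys (i, j) of a_ia_j and (i, infinity) of a_i;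
   since indices are below n, the value n serves as infinity. *)
Definition color_key (n : nat) (p : color n) : nat * nat :=
  match p with
  | inl i => (nat_of_ord i, n)
  | inr c => (nat_of_ord (val c).1, nat_of_ord (val c).2)
  end.

Definition color_le (n : nat) (p q : color n) : bool :=
  let: (i, j) := color_key p in let: (k, l) := color_key q in
  ((i < k) || ((i == k) && (j <= l)))%N.

(* [color_special a_ka_l a_ia_j]: i < j < k < l or k < i < j < l. *)
Definition color_special (n : nat) (p q : color n) : bool :=
  match p, q with
  | inr c, inr d =>
      let: (k, l) := val c in let: (i, j) := val d in
      ((i < j) && (j < k) && (k < l) || (k < i) && (i < j) && (j < l))%N
  | _, _ => false
  end.

(* Product of two distinct primary colors; when i = j there is no such
   secondary color, and the value inl i is meaningless. *)
Definition color_mul (n : nat) (i j : 'I_n) : color n :=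
  if insub (i, j) is Some c then inr c
  else if insub (j, i) is Some c then inr c
  else inl i.

(* Exponent of the primary color i in the monomial p. *)
Definition color_exp (n : nat) (p : color n) (i : 'I_n) : nat :=
  match p with
  | inl j => (i == j)
  | inr c => (i == (val c).1) + (i == (val c).2)
  end%N.

Definition part (n : nat) := (int * color n)%type.
Definition psize (n : nat) (x : part n) : int := x.1.
Definition pcolor (n : nat) (x : part n) : color n := x.2.
Definition shift (n : nat) (x : part n) (m : int) : part n := (psize x + m, pcolor x).

Definition succ (n : nat) (x y : part n) : bool :=
  (color_le (pcolor x) (pcolor y))%:Z <= psize x - psize y.
Definition succeq (n : nat) (x y : part n) : bool := succ x y || (x == y).

Definition in_P (n : nat) (x : part n) : bool := is_primary (pcolor x) && (1 <= psize x).
Definition in_S (n : nat) (x : part n) : bool := is_secondary (pcolor x) && (2 <= psize x).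

Definition ssucc (n : nat) (x y : part n) : bool :=
  if is_primary (pcolor x) || is_primary (pcolor y) then succeq x (shift y 1)
  else if color_special (pcolor x) (pcolor y) then succ x y
  else succ x (shift y 1).

Definition in_O (n : nat) (s : seq (part n)) : bool :=
  all (@in_P n) s && sorted (@succ n) s.
Definition in_E (n : nat) (s : seq (part n)) : bool :=
  all (fun x => in_P x || in_S x) s && sorted (@ssucc n) s.

Definition O_partition (n : nat) := {s : seq (part n) | in_O s}.
Definition E_partition (n : nat) := {s : seq (part n) | in_E s}.

Definition total_size (n : nat) (s : seq (part n)) : int := \sum_(x <- s) psize x.

(* Colors multiply commutatively, so the product of the colors of s is a
   monomial in the primary colors, given here by its exponents. *)
Definition color_product (n : nat) (s : seq (part n)) : {ffun 'I_n -> nat} :=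
  [ffun i => (\sum_(x <- s) color_exp (pcolor x) i)%N].

(* The halves are only used on secondary-colored parts; a primary-colored part
   is left unchanged. *)
Definition alpha (n : nat) (x : part n) : part n :=
  if pcolor x is inr c then
    let: (i, j) := val c in let k := (psize x %/ 2)%Z in
    if (2 %| psize x)%Z then (k, inl j) else (k + 1, inl i)
  else x.
Definition beta (n : nat) (x : part n) : part n :=
  if pcolor x is inr c then
    let: (i, j) := val c in let k := (psize x %/ 2)%Z in
    if (2 %| psize x)%Z then (k, inl i) else (k, inl j)
  else x.

Variant state (T : Type) : Type :=
  | Step1 of seq T
  | Step2 of seq T
  | Stop of seq T.

Definition outputs (T : Type) (next : state T -> state T) (s t : seq T) : Prop :=
  exists k : nat, iter k next (Step1 s) = Stop t.

(* [first_pair r s = Some (s1, x, y, s2)] when s = s1 ++ x :: y :: s2 and (x, y)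
   is the leftmost pair of consecutive entries with r x y. *)
Fixpoint first_pair (T : Type) (r : rel T) (s : seq T) : option (seq T * T * T * seq T) :=
  if s is x :: s' then
    if s' is y :: s2 then
      if r x y then Some ([::], x, y, s2)
      else if first_pair r s' is Some (s1, u, v, s3) then Some (x :: s1, u, v, s3)
      else None
    else None
  else None.

(* [last_entry a s = Some (s1, x, s2)] when s = s1 ++ x :: s2 and x is the
   rightmost entry with a x. *)
Fixpoint last_entry (T : Type) (a : pred T) (s : seq T) : option (seq T * T * seq T) :=
  if s is x :: s' then
    if last_entry a s' is Some (s1, u, s2) then Some (x :: s1, u, s2)
    else if a x then Some ([::], x, s')
    else None
  else None.

Definition fusible (n : nat) (x y : part n) : bool :=
  [&& in_P x, in_P y, succ x y & ~~ ssucc x y].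
Definition crossing (n : nat) (x y : part n) : bool :=
  [&& in_P x, in_S y & ~~ ssucc x y].

(* Only used when [fusible x y], in which case x and y have distinct primary
   colors (lemma [fusible_color]). *)
Definition fuse (n : nat) (x y : part n) : part n :=
  (psize x + psize y,
   match pcolor x, pcolor y with
   | inl i, inl j => color_mul i j
   | _, _ => pcolor x
   end).

Definition Phi_next (n : nat) (st : state (part n)) : state (part n) :=
  match st with
  | Step1 s =>
      if first_pair (@fusible n) s is Some (s1, x, y, s2)
      then Step2 (s1 ++ fuse x y :: s2)
      else Stop s
  | Step2 s =>
      if first_pair (@crossing n) s is Some (s1, x, y, s2)
      then Step2 (s1 ++ shift y 1 :: shift x (-1) :: s2)
      else Step1 s
  | Stop s => Stop s
  end.

(* In [Step2], the [None] case is unreachable: [Psi_next] enters [Step2] only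
   with a sequence that has an entry in S. *)
Definition Psi_next (n : nat) (st : state (part n)) : state (part n) :=
  match st with
  | Step1 s =>
      if last_entry (@in_S n) s is Some (s1, x, s2) then
        if s2 is y :: s3 then
          if in_P y && ~~ succ (beta x) y
          then Step1 (s1 ++ shift y 1 :: shift x (-1) :: s3)
          else Step2 s
        else Step2 s
      else Stop s
  | Step2 s =>
      if last_entry (@in_S n) s is Some (s1, x, s2)
      then Step1 (s1 ++ alpha x :: beta x :: s2)
      else Stop s
  | Stop s => Stop s
  end.

Definition Phi_outputs (n : nat) (s t : seq (part n)) : Prop := outputs (@Phi_next n) s t.
Definition Psi_outputs (n : nat) (s t : seq (part n)) : Prop := outputs (@Psi_next n) s t.

Lemma outputs_fun (T : Type) (next : state T -> state T) (s t t' : seq T) :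
  (forall u, next (Stop u) = Stop u) ->
  outputs next s t -> outputs next s t' -> t = t'.
Proof.
move=> stopE [k Ek] [l El].
have stuck m u : iter m next (Stop u) = Stop u by elim: m => //= m ->.
have: iter (l + k) next (Step1 s) = Stop t by rewrite iterD Ek stuck.
by rewrite addnC iterD El stuck => -[].
Qed.

Lemma Phi_outputs_fun (n : nat) (s t t' : seq (part n)) :
  Phi_outputs s t -> Phi_outputs s t' -> t = t'.
Proof. exact: outputs_fun. Qed.

Lemma Psi_outputs_fun (n : nat) (s t t' : seq (part n)) :
  Psi_outputs s t -> Psi_outputs s t' -> t = t'.
Proof. exact: outputs_fun. Qed.

Lemma fusible_color (n : nat) (x y : part n) : fusible x y ->
  exists i j : 'I_n, [/\ pcolor x = inl i, pcolor y = inl j & i != j].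
Proof.
case: x y => [k [i|c]] [l [j|d]] //; rewrite /fusible /in_P ?andbF //=.
rewrite /succ /ssucc /succeq /shift /psize /pcolor /= => /and4P[_ _ hs hn].
exists i, j; split=> //; apply/eqP=> eij; move: hs hn; rewrite -{}eij.
rewrite /succ /color_le /psize /pcolor /= eqxx leqnn orbT negb_or => hs.
by case/andP=> hns /eqP ne; case: ne; congr (_, _); lia.
Qed.

(* Main.v *)
Require Import Defs.
From mathcomp Require Import all_boot all_order all_algebra.
From mathcomp Require Import zify.

(* Just before each Step 1 of Phi, the sequence has the form A ++ B, where A is
   sorted for >> and ends with the last secondary part, and B, made of primary
   parts only, is sorted for \succ.  The next fusion takes place inside B, at
   consecutive parts y = alpha(e) and z = beta(e), and e then crosses some of
   the parts preceding y.  Since beta(e + 1) = alpha(e) and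
   alpha(e + 1) = beta(e) + 1, comparing a neighbour with beta(e) tells whether
   e has crossed it, so Psi undoes Phi one elementary move at a time; this also
   gives injectivity, Psi being deterministic.  The output is sorted for >>
   because consecutive secondary parts are compared through their halves:
   beta(d) \succ alpha(e) + m implies d >> e + m, and alpha(e) \succeq alpha(d)
   together with beta(d) \succ beta(e) implies d + 1 >> e. *)

Set Implicit Arguments.
Unset Strict Implicit.
Unset Printing Implicit Defensive.

Import Order.TTheory GRing.Theory Num.Theory.

Local Open Scope ring_scope.

Local Notation dec := (fun x => shift x (-1)).

(** * Orders on colored parts, reduced to arithmetic *)

Section Parts.
Variable n : nat.
Implicit Types (x y z d e w : part n).

Definition key x : nat * nat := color_key (pcolor x).

(** Indices stay below [n], so the second component [n] occurs only for primary colors. *)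
Lemma color_key_inj : injective (@color_key n).
Proof.
case=> [i|[[i1 i2] hi]] [j|[[j1 j2] hj]] /= [].
- by move=> /val_inj ->.
- by move=> _ e; move: (ltn_ord j2); rewrite -e ltnn.
- by move=> _ e; move: (ltn_ord i2); rewrite e ltnn.
by move=> /val_inj e1 /val_inj e2; congr inr; apply: val_inj; rewrite /= e1 e2.
Qed.

(** A lexicographic form on sizes and keys, on which [lia] can decide comparisons. *)
Lemma succE x y : succ x y =
  (psize y < psize x) || (psize x == psize y) &&
  (((key y).1 < (key x).1) || ((key y).1 == (key x).1) && ((key y).2 < (key x).2))%N.
Proof.
rewrite /succ /color_le /key.
by case: (color_key _) => i j; case: (color_key _) => k l /=; lia.
Qed.

Lemma succ_asym x y : succ x y -> ~~ succ y x.
Proof. by rewrite !succE; lia. Qed.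

Lemma key_shift x m : key (shift x m) = key x. Proof. by []. Qed.
Lemma psize_shift x m : psize (shift x m) = psize x + m. Proof. by []. Qed.

Definition partE := (succE, key_shift, psize_shift).

Lemma shift0 x : shift x 0 = x.
Proof. by case: x => k p; rewrite /shift /psize /= addr0. Qed.

Lemma shiftD x a b : shift (shift x a) b = shift x (a + b).
Proof. by rewrite /shift /psize /= addrA. Qed.

Lemma succeqE x y : succeq x y = ~~ succ y x.
Proof.
rewrite /succeq; case: eqVneq => [->|ne]; first by rewrite orbT !succE; lia.
have: (psize x != psize y) || (key x != key y).
  case: x y ne => k p [l q]; rewrite /psize /key /= => ne; apply/norP.
  by rewrite !negbK => -[/eqP ek /eqP /color_key_inj ep]; rewrite ek ep eqxx in ne.
by rewrite orbF !succE -pair_eqE /=; lia.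
Qed.

Lemma ssucc_primary x y : is_primary (pcolor x) || is_primary (pcolor y) ->
  ssucc x y = ~~ succ (shift y 1) x.
Proof. by rewrite /ssucc => ->; rewrite succeqE. Qed.

Lemma succ_shift x y m : succ (shift x m) (shift y m) = succ x y.
Proof. by rewrite !partE; lia. Qed.

Lemma succ_shift1 x y : succ (shift x 1) y = succ x (shift y (-1)).
Proof. by rewrite !partE; lia. Qed.

Lemma ssucc_shift x y m : ssucc (shift x m) (shift y m) = ssucc x y.
Proof.
rewrite /ssucc !succeqE /=.
have -> : shift (shift y m) 1 = shift (shift y 1) m by rewrite !shiftD addrC.
by rewrite !succ_shift.
Qed.

Lemma in_P_primary x : in_P x -> is_primary (pcolor x).
Proof. by case/andP. Qed.

Lemma in_P_notS x : in_P x -> ~~ in_S x.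
Proof. by rewrite /in_P /in_S /is_secondary => /andP[->]. Qed.

Lemma in_S_notP x : in_S x -> ~~ in_P x.
Proof. by apply: contraL; apply: in_P_notS. Qed.

Lemma in_S_shift x (m : nat) : in_S x -> in_S (shift x m%:Z).
Proof. by rewrite /in_S psize_shift => /andP[-> /=]; lia. Qed.

Lemma in_P_succeq x y : in_P y -> ~~ succ y x -> is_primary (pcolor x) -> in_P x.
Proof.
by move=> /andP[_ hy] hs hx; rewrite /in_P hx; move: hs; rewrite succE; lia.
Qed.

(** As x is at least y + 1, x - 1 is at least y, whose size is positive. This keeps crossed parts
    positive. *)
Lemma in_P_ssucc x y : in_P x -> in_P y -> ssucc x y -> in_P (shift x (-1)).
Proof.
move=> hx hy; rewrite ssucc_primary ?in_P_primary // => h.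
apply: in_P_succeq hy _ _; last exact: in_P_primary hx.
by move: h; rewrite !partE; lia.
Qed.

(** * Halves of secondary parts, and fusion *)

Variant halves_spec d : part n -> part n -> Type :=
| HalvesEven k (i j : 'I_n) h of d = (k *+ 2, inr (exist _ (i, j) h)) :
    halves_spec d (k, inl j) (k, inl i)
| HalvesOdd k (i j : 'I_n) h of d = (k *+ 2 + 1, inr (exist _ (i, j) h)) :
    halves_spec d (k + 1, inl i) (k, inl j).

(** Naming the half [k] of the size by parity removes division, so that [lia] applies. *)
Lemma halvesP d : is_secondary (pcolor d) -> halves_spec d (alpha d) (beta d).
Proof.
case: d => m [//|[[i j] h]] _; rewrite /alpha /beta /psize /=.
case: ifP => hm.
  by apply: HalvesEven; congr pair; lia.
by apply: HalvesOdd; congr pair; lia.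
Qed.

Lemma in_S_secondary x : in_S x -> is_secondary (pcolor x).
Proof. by case/andP. Qed.

Lemma alpha_shift1 d : is_secondary (pcolor d) -> alpha (shift d 1) = shift (beta d) 1.
Proof.
by case: d => m [//|[[i j] h]] _; rewrite /alpha /beta /shift /psize /=;
   case: ifP; case: ifP => ? ? //=; congr pair; lia.
Qed.

Lemma beta_shift1 d : is_secondary (pcolor d) -> beta (shift d 1) = alpha d.
Proof.
by case: d => m [//|[[i j] h]] _; rewrite /alpha /beta /shift /psize /=;
   case: ifP; case: ifP => ? ? //=; congr pair; lia.
Qed.

Lemma succ_alpha_beta d : is_secondary (pcolor d) -> succ (alpha d) (beta d).
Proof.
by move/halvesP; case=> k i j h _; rewrite !partE /key /psize /=; move: (h) => /=; lia.
Qed.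

Lemma in_P_alpha d : in_S d -> in_P (alpha d).
Proof.
move=> /andP[]; case: d => m [//|[[i j] h]] _; rewrite /in_P /alpha /psize /=.
by case: ifP => /=; lia.
Qed.

(** The size of [d] is at least twice that of [beta d]; the only tight case is size 2 over size 1,
    where the colors decide. *)
Lemma ssucc_beta d w : is_secondary (pcolor d) -> in_P w -> succ (beta d) w -> ssucc d w.
Proof.
move=> hd /andP[hp hw]; rewrite ssucc_primary ?hp ?orbT //; move: hp hw.
case: w => l [q|//] _; case: (halvesP hd) => k i j h ->;
  rewrite !partE /key /psize /=; move: (h) => /=; lia.
Qed.

(** Let (i, j) and (i', j') be the colors of [d] and [e]. Special pairs are needed only when m = 0
    and the compared halves have equal sizes: i' < j' < i < j if [d] and [e] are even, i < i' < j' <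
    j if only [d] is odd. *)
Lemma ssucc_halves d e m : is_secondary (pcolor d) -> is_secondary (pcolor e) ->
  0 <= m -> succ (beta d) (shift (alpha e) m) -> ssucc d (shift e m).
Proof.
move=> hd he; case: (halvesP hd) => k i j h ->; case: (halvesP he) => l i' j' h' ->;
  rewrite /ssucc !partE /key /psize /=; move: (h) (h') => /=; case: ifP; lia.
Qed.

(** The halves of [d] lie between those of [e], so all four sizes are within 1 of one another;
    special pairs settle what sizes and color order leave open. *)
Lemma ssucc_halves1 d e : is_secondary (pcolor d) -> is_secondary (pcolor e) ->
  ~~ succ (alpha d) (alpha e) -> succ (beta d) (beta e) -> ssucc (shift d 1) e.
Proof.
move=> hd he; case: (halvesP hd) => k i j h ->; case: (halvesP he) => l i' j' h' ->;
  rewrite /ssucc !partE /key /psize /=; move: (h) (h') => /=; case: ifP; lia.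
Qed.

Lemma color_mulC (i j : 'I_n) : i != j -> color_mul i j = color_mul j i.
Proof.
rewrite -val_eqE neq_ltn /color_mul => /orP[] h.
  by rewrite insubT insubN //= -leqNgt ltnW.
by rewrite insubN ?insubT //= -leqNgt ltnW.
Qed.

Lemma color_mul_lt (i j : 'I_n) (h : (i < j)%N) : color_mul i j = inr (exist _ (i, j) h).
Proof. by rewrite /color_mul insubT. Qed.

(** Lying above y and below y + 1 leaves two cases: equal sizes with the larger color first, or
    sizes differing by 1 with the smaller color first. These are the halves of an even and of an odd
    part. *)
Lemma fuseP x y : fusible x y ->
  [/\ in_S (fuse x y), alpha (fuse x y) = x & beta (fuse x y) = y].
Proof.
move=> f; have [p [q [ep eq ne]]] := fusible_color f.
case/and4P: f; case: x y ep eq => k c [l c'] /= -> -> {c c'} hx hy hs.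
rewrite ssucc_primary // negbK; move: hx hy hs; rewrite /in_P !partE /psize /key /=.
move=> hk hl hs hn; rewrite /fuse /=.
have [lt|le] := ltnP p q.
  have -> : k = l + 1 by lia.
  rewrite color_mul_lt /in_S /alpha /beta /psize /=; split; first by lia.
    by case: ifP => h; congr pair; lia.
  by case: ifP => h; congr pair; lia.
have lt : (q < p)%N by move: ne; rewrite -val_eqE /=; lia.
have -> : k = l by lia.
rewrite color_mulC // color_mul_lt /in_S /alpha /beta /psize /=; split; first by lia.
  by case: ifP => h; congr pair; lia.
by case: ifP => h; congr pair; lia.
Qed.

End Parts.

(** * Leftmost and rightmost searches, and runs of a machine *)

Section Search.
Variable T : Type.
Implicit Types (r : rel T) (a : pred T) (s : seq T).

Lemma first_pair_cat r s1 x y s2 : sorted (fun u v => ~~ r u v) (rcons s1 x) -> r x y ->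
  first_pair r (s1 ++ x :: y :: s2) = Some (s1, x, y, s2).
Proof.
move=> hs rxy; elim: s1 hs => [|u [|v s1] IH] /=; first by rewrite rxy.
  by rewrite andbT => /negbTE ->; rewrite rxy.
by case/andP=> /negbTE -> hs; have /= -> := IH hs.
Qed.

Lemma first_pair_none r s : sorted (fun u v => ~~ r u v) s -> first_pair r s = None.
Proof.
elim: s => [|u [|v s] IH] //= /andP[/negbTE -> hs].
by have /= -> := IH hs.
Qed.

Lemma first_pair_inv r s s1 x y s2 : first_pair r s = Some (s1, x, y, s2) ->
  s = s1 ++ x :: y :: s2 /\ r x y.
Proof.
elim: s s1 => [|u [|v s] IH] s1 //=; case: ifP => [ruv [<- <- <- <-] //|_].
move: IH => /=; case: (if s is _ :: _ then _ else _) => [[[[t1 x'] y'] t2]|] // IH.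
by case=> <- ? ? ?; subst x' y' t2; have [/= -> rxy] := IH t1 erefl.
Qed.

Lemma last_entry_cat a s1 x s2 : a x -> all (predC a) s2 ->
  last_entry a (s1 ++ x :: s2) = Some (s1, x, s2).
Proof.
move=> ax h2; have n2 : last_entry a s2 = None.
  by elim: s2 h2 => //= y s2 IH /andP[/negbTE -> /IH ->].
by elim: s1 => [|u s1 IH] /=; rewrite ?n2 ?ax ?IH.
Qed.

Lemma last_entry_none a s : all (predC a) s -> last_entry a s = None.
Proof. by elim: s => //= y s IH /andP[/negbTE -> /IH ->]. Qed.

(** Locates the leftmost failure, at the seam or inside [s2], with a sorted prefix before it as
    [first_pair_cat] will require. *)
Lemma sortedN_cat r s1 s2 : sorted r s1 -> ~~ sorted r (s1 ++ s2) ->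
  (exists s1' x y s2', [/\ s1 = rcons s1' x, s2 = y :: s2' & ~~ r x y]) \/
  (exists s x y s2', [/\ s2 = s ++ x :: y :: s2', sorted r (s1 ++ rcons s x) & ~~ r x y]).
Proof.
elim: s2 s1 => [|z s2 IH] s1 h1; first by rewrite cats0 h1.
rewrite -cat_rcons => h; case h1z: (sorted r (rcons s1 z)).
  have [[s1' [x [y [s2' [/rcons_inj [_ <-] -> nr]]]]]|] := IH _ h1z h.
    by right; exists [::], z, y, s2'; rewrite cats1.
  case=> s [x [y [s2' [-> hs nr]]]].
  by right; exists (z :: s), x, y, s2'; split=> //; rewrite -cat_rcons.
left; case/lastP: s1 h1 h1z {h IH} => [|s1 x] // h1.
rewrite -cats1 cat_rcons sorted_cat_cons h1 /= andbT => nr.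
by exists s1, x, z, s2; rewrite nr.
Qed.

Definition reach (next : state T -> state T) (st st' : state T) : Prop :=
  exists k : nat, iter k next st = st'.

Lemma reach_refl next st : reach next st st.
Proof. by exists 0%N. Qed.

Lemma reach_step next st st' : reach next (next st) st' -> reach next st st'.
Proof. by case=> k <-; exists k.+1; rewrite iterSr. Qed.

Lemma reach_trans next st2 st1 st3 :
  reach next st1 st2 -> reach next st2 st3 -> reach next st1 st3.
Proof. by move=> [k <-] [l <-]; exists (l + k)%N; rewrite iterD. Qed.

End Search.

(** * Elementary moves of the two machines *)

Section Machines.
Variable n : nat.
Implicit Types (x y z d e w : part n) (A B C X W s mu : seq (part n)).

Lemma ssucc_not_fusible : subrel (@ssucc n) (fun x y => ~~ fusible x y).
Proof. by move=> x y h; rewrite /fusible h !andbF. Qed.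

Lemma ssucc_not_crossing : subrel (@ssucc n) (fun x y => ~~ crossing x y).
Proof. by move=> x y h; rewrite /crossing h !andbF. Qed.

Lemma Phi_stop s : sorted (@ssucc n) s -> Phi_next (Step1 s) = Stop s.
Proof.
by move=> h /=; rewrite first_pair_none //; apply: sub_sorted h; apply: ssucc_not_fusible.
Qed.

Lemma Phi_fuse A y z C : sorted (@ssucc n) (rcons A y) -> fusible y z ->
  Phi_next (Step1 (A ++ y :: z :: C)) = Step2 (A ++ fuse y z :: C).
Proof.
by move=> h f /=; rewrite first_pair_cat //; apply: sub_sorted h; apply: ssucc_not_fusible.
Qed.

Lemma Phi_cross A x d C : sorted (@ssucc n) (rcons A x) -> crossing x d ->
  Phi_next (Step2 (A ++ x :: d :: C)) = Step2 (A ++ shift d 1 :: shift x (-1) :: C).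
Proof.
by move=> h f /=; rewrite first_pair_cat //; apply: sub_sorted h; apply: ssucc_not_crossing.
Qed.

Lemma Phi_crossed A d C : sorted (fun x y => ~~ crossing x y) (rcons A d) -> all (@in_P n) C ->
  Phi_next (Step2 (A ++ d :: C)) = Step1 (A ++ d :: C).
Proof.
move=> h hC /=; rewrite first_pair_none // sorted_cat_cons h {h}.
elim: C d hC => //= x C IH d /andP[hx /IH ->]; rewrite andbT.
by rewrite /crossing (negbTE (in_P_notS hx)) andbF.
Qed.

Lemma all_P_notS C : all (@in_P n) C -> all (predC (@in_S n)) C.
Proof. by apply: sub_all => x /in_P_notS. Qed.

Lemma Psi_stop s : all (@in_P n) s -> Psi_next (Step1 s) = Stop s.
Proof. by move=> h /=; rewrite last_entry_none ?all_P_notS. Qed.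

Lemma Psi_split A d C : in_S d -> all (@in_P n) C -> path (@succ n) (beta d) C ->
  reach (@Psi_next n) (Step1 (A ++ d :: C)) (Step1 (A ++ alpha d :: beta d :: C)).
Proof.
(* Two moves: Step 1 finds nothing to cross, then Step 2 splits [d]. *)
move=> hd hC hp; exists 2 => /=; rewrite last_entry_cat ?all_P_notS //.
case: C hC hp => [|y C] hC /=; first by rewrite last_entry_cat.
by case/andP=> -> _; rewrite andbF /= last_entry_cat // all_P_notS.
Qed.

Lemma Psi_cross A d x C : in_S d -> all (@in_P n) (x :: C) -> ~~ succ (beta d) x ->
  Psi_next (Step1 (A ++ d :: x :: C)) = Step1 (A ++ shift x 1 :: shift d (-1) :: C).
Proof.
move=> hd hC hn; rewrite /= last_entry_cat ?all_P_notS //.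
by case/andP: hC => -> _; rewrite hn.
Qed.

(** * Conservation of size and color product *)

Definition state_parts (st : state (part n)) : seq (part n) :=
  match st with Step1 s | Step2 s | Stop s => s end.

Lemma color_exp_fuse x y i : fusible x y ->
  color_exp (pcolor (fuse x y)) i = (color_exp (pcolor x) i + color_exp (pcolor y) i)%N.
Proof.
move=> f; have [p [q [ep eq ne]]] := fusible_color f.
rewrite /fuse /= ep eq; case: (ltngtP p q) => [h|h|/val_inj h].
- by rewrite color_mul_lt.
- by rewrite color_mulC // color_mul_lt /= addnC.
by rewrite h eqxx in ne.
Qed.

Lemma Phi_next_total st :
  total_size (state_parts (Phi_next st)) = total_size (state_parts st).
Proof.
case: st => s //=; case E: (first_pair _ s) => [[[[s1 x] y] s2]|] //=;
  have [-> _] := first_pair_inv E; rewrite /total_size !big_cat !big_cons /= /psize; lia.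
Qed.

Lemma Phi_next_color st :
  color_product (state_parts (Phi_next st)) = color_product (state_parts st).
Proof.
case: st => s //=; case E: (first_pair _ s) => [[[[s1 x] y] s2]|] //=;
  have [-> f] := first_pair_inv E; apply/ffunP=> i; rewrite !ffunE !big_cat !big_cons.
  by rewrite (color_exp_fuse _ f) /=; lia.
by rewrite /=; lia.
Qed.

(** * Crossings after a fusion *)

Lemma sorted_rcons_rcons (r : rel (part n)) s x y :
  sorted r (rcons (rcons s x) y) = sorted r (rcons s x) && r x y.
Proof. by rewrite -[rcons (rcons _ _) y]cats1 cat_rcons sorted_cat_cons /= andbT. Qed.

(** Failure of x >> d means that d + 1 is above x, and x is (x - 1) + 1. *)
Lemma crossing_ssucc x d : crossing x d -> ssucc (shift d 1) (shift x (-1)).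
Proof.
case/and3P=> /in_P_primary hx _; rewrite ssucc_primary ?hx // negbK.
by rewrite ssucc_primary /= ?hx ?orbT // !partE; lia.
Qed.

(** The fused part [d] crosses a final segment [X2] of [X], from right to left, and cannot pass the
    secondary part that ends [A]. The comparison of [X] with [alpha d], which followed it before the
    fusion, is what lets Psi go back at each move. *)
Lemma Phi_crossings A C X d :
  (forall A0 c, A = rcons A0 c -> in_S c) -> all (@in_P n) X ->
  sorted (@ssucc n) (A ++ X) -> sorted (@ssucc n) (rcons X (alpha d)) -> in_S d ->
  all (@in_P n) C ->
  exists X1 X2, [/\ X = X1 ++ X2,
    reach (@Phi_next n) (Step2 (A ++ X ++ d :: C))
      (Step1 (A ++ X1 ++ shift d (size X2)%:Z :: map dec X2 ++ C)),
    reach (@Psi_next n) (Step1 (A ++ X1 ++ shift d (size X2)%:Z :: map dec X2 ++ C))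
      (Step1 (A ++ X ++ d :: C)),
    sorted (@ssucc n) (rcons X1 (shift d (size X2)%:Z))
  & forall x X', X2 = x :: X' -> ssucc (shift d (size X2)%:Z) (shift x (-1))].
Proof.
move=> hA; elim/last_ind: X d C => [|X x IH] d C hX hAX hXd hd hC.
  exists [::], [::]; rewrite /= shift0; split=> //; last exact: reach_refl.
  apply: reach_step; rewrite Phi_crossed //; first exact: reach_refl.
  case/lastP: A hA hAX => // A c hA; rewrite cats0 sorted_rcons_rcons => hAc.
  rewrite (sub_sorted ssucc_not_crossing) //= /crossing.
  by rewrite (negbTE (in_S_notP (hA _ _ erefl))).
move: hX; rewrite all_rcons => /andP[hx hX].
move: hXd; rewrite sorted_rcons_rcons => /andP[hXx hxd].
rewrite -rcons_cat in hAX.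
have [hc|hc] := boolP (crossing x d); last first.
  exists (rcons X x), [::]; rewrite /= cats0 shift0; split=> //; last 1 first.
  - rewrite sorted_rcons_rcons hXx /=; move: hc; rewrite /crossing hx hd /=; exact: negbNE.
  - apply: reach_step; rewrite catA Phi_crossed //; first exact: reach_refl.
    by rewrite -rcons_cat sorted_rcons_rcons hc (sub_sorted ssucc_not_crossing).
  exact: reach_refl.
have hd2 := in_S_secondary hd; have hda := in_P_alpha hd.
have hd1 : in_S (shift d 1) := in_S_shift 1 hd.
have hx1 : in_P (shift x (-1)) by apply: in_P_ssucc hx hda hxd.
have hxd' : ~~ succ (shift (alpha d) 1) x.
  by rewrite -ssucc_primary // in_P_primary.
have [|||X1 [X2 [eX r1 r2 h1 h2]]] := IH (shift d 1) (shift x (-1) :: C) hX _ _ hd1.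
- by move: hAX; rewrite -cats1 => /cat_sorted2[].
(* x' is at least x + 1, hence at least alpha(d) + 2, which is above beta(d) + 2 = alpha(d + 1) +
   1. *)
- case/lastP: X hX hXx {IH hAX} => // X x'; rewrite all_rcons => /andP[hx' _].
  rewrite !sorted_rcons_rcons => /andP[-> /=]; rewrite !ssucc_primary ?in_P_primary ?in_P_alpha //.
  rewrite alpha_shift1 //; move: (succ_alpha_beta hd2) hxd'; clear.
  by rewrite !partE; lia.
- by rewrite /= hx1.
have ez : shift (shift d 1) (size X2)%:Z = shift d (size (rcons X2 x))%:Z.
  by rewrite shiftD size_rcons intS.
rewrite ez in r1 r2 h1 h2.
exists X1, (rcons X2 x); rewrite eX -rcons_cat map_rcons !cat_rcons; split=> //.
- by apply: reach_step; rewrite -eX catA Phi_cross // -?catA.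
(* Psi undoes this crossing last: beta(d + 1) = alpha(d) is not above x - 1, because x >>
   alpha(d). *)
- apply: reach_trans r2 _; apply: reach_step.
  rewrite -eX catA Psi_cross //=; last 1 first.
  + by rewrite beta_shift1 // -succ_shift1.
  + by rewrite !shiftD addNr subrr !shift0 -!catA /=; apply: reach_refl.
  by apply/andP.
case: X2 h2 {r1 r2 h1} eX ez => [|x' X2] h2 eX ez y X' /=.
  by case=> <- _; rewrite -ez /= shift0; apply: crossing_ssucc.
by case=> <- _; apply: h2.
Qed.

(* The state is [A ++ B].  In the second alternative, the last entry of [A] was
   fused as [d] and then crossed all of [X]: before the fusion, [X] was followed
   by [alpha d], [beta d] and [W]. *)
Definition Phi_inv A B : Prop :=
  [/\ all (fun x => in_P x || in_S x) A, in_O B, sorted (@ssucc n) (A ++ take 1 B)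
    & A = [::] \/ exists A0 d X W,
      [/\ A = rcons A0 (shift d (size X)%:Z), B = map dec X ++ W, in_S d,
          sorted (@ssucc n) (rcons X (alpha d)) & path (@succ n) (beta d) W]].

(** * Comparisons along chains of primary parts *)

Lemma ssucc_in_P x y : in_P x -> ssucc x y = ~~ succ (shift y 1) x.
Proof. by move=> h; rewrite ssucc_primary // in_P_primary. Qed.

(** Each [ssucc] between primary parts gains at least 1 in size, and the gains add up to the length
    of [s]. *)
Lemma succ_chain s b x : all (@in_P n) s -> sorted (@ssucc n) (rcons s x) ->
  succ b (head x s) -> succ b (shift x (size s)%:Z).
Proof.
elim: s b => [|u s IH] b /=; first by rewrite shift0.
case/andP=> hu hs hp hb.
have {}IH := IH (shift b (-1)) hs (path_sorted hp).
have hh : ssucc u (head x s) by case: s hp {hs IH} => [|v s] /= /andP[].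
move: IH; rewrite !partE; move: hh hb; rewrite ssucc_in_P // !partE; lia.
Qed.

Lemma path_succ_weak u v s : ~~ succ v u -> path (@succ n) v s -> path (@succ n) u s.
Proof. by case: s => //= w s huv /andP[hvw ->]; move: huv hvw; rewrite !succE; lia. Qed.

(** For consecutive x, u in [X], x - 1 is at least u, which is above u - 1; at the end, x - 1 is at
    least y, which is above [C]. *)
Lemma path_succ_dec X y C : all (@in_P n) X -> sorted (@ssucc n) (rcons X y) ->
  path (@succ n) y C -> path (@succ n) (head y X) (map dec X ++ C).
Proof.
elim: X => //= x X IH /andP[hx hX] hp hC.
apply/andP; split; first by rewrite !partE; lia.
apply: path_succ_weak (IH hX (path_sorted hp) hC).
have : ssucc x (head y X) by case: X hp {hX IH} => [|v s] /= /andP[].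
by rewrite ssucc_in_P // !partE; lia.
Qed.

Lemma all_P_dec X y : all (@in_P n) (rcons X y) -> sorted (@ssucc n) (rcons X y) ->
  all (@in_P n) (map dec X).
Proof.
elim: X => //= x X IH /andP[hx hX] hp; rewrite (IH hX (path_sorted hp)) andbT.
have /andP[hh _] : in_P (head y X) && ssucc x (head y X).
  by case: X hp hX {IH} => [|v s] /= /andP[-> _] /andP[->].
apply: in_P_ssucc hx hh _.
by case: X hp {hX IH} => [|v s] /= /andP[].
Qed.

Lemma sorted_dec X : sorted (@ssucc n) X -> sorted (@ssucc n) (map dec X).
Proof. by rewrite sorted_map; apply: sub_sorted => x y /=; rewrite ssucc_shift. Qed.

(* By the last clause, the part fused from [y] and [z] may cross all of [B1] and
   still lie below the last entry of [A]. *)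
Lemma Phi_inv_violation A B : Phi_inv A B -> ~~ sorted (@ssucc n) (A ++ B) ->
  exists B1 y z B2, [/\ B = B1 ++ y :: z :: B2, sorted (@ssucc n) (A ++ rcons B1 y),
    fusible y z & forall A0 c, A = rcons A0 c ->
      in_S c /\ ssucc c (shift (fuse y z) (size B1)%:Z)].
Proof.
case=> hA /andP[hPB hsB] hAB hor hn.
have fus B1 y z B2 : B = B1 ++ y :: z :: B2 -> ~~ ssucc y z -> fusible y z.
  move=> e nyz; move: hPB hsB; rewrite /fusible nyz andbT e all_cat sorted_cat_cons /=.
  by case/and4P=> _ -> -> _ /and3P[_ ->].
case: hor => [eA|[A0 [d [X [W [eA eB hd hXd hW]]]]]].
  subst A; have [[s1' [x [y [s2' []]]]]|] := sortedN_cat (isT : sorted (@ssucc n) [::]) hn.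
    by case: s1'.
  case=> B1 [y [z [B2 [eB hs nyz]]]]; exists B1, y, z, B2; split=> //.
    exact: fus eB nyz.
  by case.
have hd2 := in_S_secondary hd.
have hc : in_S (shift d (size X)%:Z) := in_S_shift _ hd.
have hAX : sorted (@ssucc n) (A ++ map dec X).
  have hX : sorted (@ssucc n) (map dec X).
    by apply: sorted_dec; move: hXd; rewrite -cats1 => /cat_sorted2[].
  case: X eB hX {eA hXd hc} => [|x X] eB hX.
    by rewrite cats0; case/cat_sorted2: hAB.
  move: hAB; rewrite eB /= take0 cats1 => hAx.
  by rewrite sorted_cat_cons hAx.
have hn' := hn; rewrite eB catA in hn'.
case: (sortedN_cat hAX hn') => {hn'}.
  case=> s1 [y [z [B2 [e1 e2 nyz]]]].
  case/lastP: X => [|X x] in eA eB hXd hc hAX e1 *.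
    move: hAB nyz; rewrite eB e2 /= take0 cats1.
    by rewrite cats0 in e1; rewrite e1 sorted_rcons_rcons => /andP[_ ->].
  move: e1; rewrite map_rcons -rcons_cat => /rcons_inj[_ ey].
  have eB' : B = map dec X ++ y :: z :: B2 by rewrite eB e2 map_rcons cat_rcons ey.
  have f := fus _ _ _ _ eB' nyz.
  exists (map dec X), y, z, B2; split=> //.
    by move: hAX; rewrite map_rcons ey.
  move=> A1 c; rewrite eA => /rcons_inj[_ <-]; split=> //.
  (* Here y = x - 1 is the last crossed part and is not counted in [B1], hence the extra 1. *)
  have -> : shift d (size (rcons X x))%:Z = shift (shift d 1) (size (map dec X))%:Z.
    by rewrite shiftD size_map size_rcons intS.
  have [he ea eb] := fuseP f; rewrite ssucc_shift.
  (* alpha(e) = x - 1 is at least alpha(d) because x >> alpha(d), and beta(e) = z heads [W], below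
     beta(d). *)
  apply: ssucc_halves1 => //; first exact: in_S_secondary.
    rewrite ea; move: hXd; rewrite sorted_rcons_rcons => /andP[_].
    have hy : in_P y by case/and4P: f.
    have hx : is_primary (pcolor x) by have := in_P_primary hy; rewrite -ey.
    by rewrite ssucc_primary ?hx // -ey -succ_shift1.
  by move: hW; rewrite eb e2 /= => /andP[].
(* The failure is inside [W]: going down from beta(d) along [s] to y = alpha(e) shows that beta(d)
   is above alpha(e) + [size s]. *)
case=> s [y [z [B2 [e2 hs nyz]]]].
have eB' : B = (map dec X ++ s) ++ y :: z :: B2 by rewrite eB e2 catA.
have f := fus _ _ _ _ eB' nyz.
exists (map dec X ++ s), y, z, B2; split=> //; first by rewrite rcons_cat catA.
move=> A1 c; rewrite eA => /rcons_inj[_ <-]; split=> //.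
have [he ea eb] := fuseP f.
have -> : shift (fuse y z) (size (map dec X ++ s))%:Z
          = shift (shift (fuse y z) (size s)%:Z) (size X)%:Z.
  by rewrite shiftD size_cat size_map PoszD addrC.
rewrite ssucc_shift; apply: ssucc_halves => //; first exact: in_S_secondary.
rewrite ea; apply: succ_chain.
- by move: hPB; rewrite eB' !all_cat => /andP[/andP[]].
- by case/cat_sorted2: hs.
by move: hW; rewrite e2; case: (s) => [|u s'] /= /andP[].
Qed.

(** * Rounds of Phi and their reversal by Psi *)

Lemma Phi_inv_step A B : Phi_inv A B -> ~~ sorted (@ssucc n) (A ++ B) ->
  exists A' B', [/\ Phi_inv A' B', (size B' < size B)%N,
    reach (@Phi_next n) (Step1 (A ++ B)) (Step1 (A' ++ B'))
  & reach (@Psi_next n) (Step1 (A' ++ B')) (Step1 (A ++ B))].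
Proof.
move=> hinv hn; have [B1 [y [z [B2 [eB hAy f hc]]]]] := Phi_inv_violation hinv hn.
case: hinv => hA /andP[hPB hsB] _ _.
have [he ea eb] := fuseP f; set e := fuse y z in hc he ea eb.
move: hPB hsB; rewrite eB all_cat sorted_cat_cons /= => /and4P[hB1 hy hz hB2] /and3P[_ hyz hzB2].
have hAB1 : sorted (@ssucc n) (A ++ B1).
  by move: hAy; rewrite -rcons_cat -cats1 => /cat_sorted2[].
have hB1y : sorted (@ssucc n) (rcons B1 y) by case/cat_sorted2: hAy.
have hAS A0 c : A = rcons A0 c -> in_S c by case/hc.
have hB1e : sorted (@ssucc n) (rcons B1 (alpha e)) by rewrite ea.
have [X1 [X2 [eX r1 r2 h1 h2]]] := Phi_crossings hAS hB1 hAB1 hB1e he hB2.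
set e' := shift e _ in r1 r2 h1 h2.
have he' : in_S e' := in_S_shift _ he.
(* [A] is extended up to the fused part in its final place; the second block shrinks as [y] and [z]
   leave it. *)
exists (A ++ rcons X1 e'), (map dec X2 ++ B2).
have eS : (A ++ rcons X1 e') ++ map dec X2 ++ B2 = A ++ X1 ++ e' :: map dec X2 ++ B2.
  by rewrite -catA cat_rcons.
have hX2y : sorted (@ssucc n) (rcons X2 y).
  by move: hB1y; rewrite eX rcons_cat => /cat_sorted2[].
have [hX1 hX2] : all (@in_P n) X1 /\ all (@in_P n) X2.
  by apply/andP; rewrite -all_cat -eX.
split.
- split.
  + by rewrite all_cat hA all_rcons he' orbT /=; apply: sub_all hX1 => x ->.
  + apply/andP; split.
      by rewrite all_cat hB2 andbT; apply: (@all_P_dec X2 y) => //; rewrite all_rcons hy.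
    apply: (@path_sorted _ _ (head y X2)); apply: path_succ_dec => //.
    by apply: path_succ_weak (succ_asym hyz) hzB2.
  + have hAe : sorted (@ssucc n) (rcons (A ++ X1) e').
      case/lastP: X1 eX h1 {r1 r2 eS hX1} => [|X1 x] eX h1.
        (* All of [B1] was crossed: the last clause of [Phi_inv_violation] applies. *)
        rewrite cats0; case/lastP: A hc hAB1 {hA hAy hn hAS} => // A0 c hc hAB1.
        rewrite sorted_rcons_rcons; case/cat_sorted2: hAB1 => -> _.
        by have [_] := hc A0 c erefl; rewrite eX.
      rewrite -rcons_cat sorted_rcons_rcons; move: h1; rewrite sorted_rcons_rcons => /andP[_ ->].
      by move: hAB1; rewrite eX catA -rcons_cat => /cat_sorted2[->].
    rewrite -rcons_cat cat_rcons sorted_cat_cons hAe /=.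
    (* If nothing was crossed, the next part is the head of [B2], below z = beta(e). *)
    move: (h2); rewrite /e'; case: (X2) => [|x X2'] {}h2 /=.
      rewrite shift0; case: (B2) hzB2 hB2 => //= w B2' /andP[hzw _] /andP[hw _].
      by rewrite take0 /= andbT ssucc_beta ?in_S_secondary // eb.
    by rewrite take0 /= andbT (h2 x X2' erefl).
  right; exists (A ++ X1), e, X2, B2; split=> //.
  + by rewrite -rcons_cat.
  + by rewrite ea.
  by rewrite eb.
- by rewrite !size_cat /= eX size_cat size_map; clear; lia.
- rewrite eS; apply: reach_step; rewrite catA Phi_fuse -?catA //.
  by rewrite rcons_cat.
rewrite eS; apply: reach_trans r2 _; rewrite !catA -ea -eb; apply: Psi_split => //.
by rewrite eb.
Qed.

Lemma Phi_inv_run A B : Phi_inv A B -> exists mu, [/\ in_E mu,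
  reach (@Phi_next n) (Step1 (A ++ B)) (Stop mu)
  & reach (@Psi_next n) (Step1 mu) (Step1 (A ++ B))].
Proof.
have [m] := ubnP (size B); elim: m A B => // m IH A B hm hinv.
have [hs|hn] := boolP (sorted (@ssucc n) (A ++ B)).
  exists (A ++ B); split; last exact: reach_refl.
    case: hinv => hA /andP[hB _] _ _; rewrite /in_E hs andbT all_cat hA /=.
    by apply: sub_all hB => x ->.
  by apply: reach_step; rewrite Phi_stop //; apply: reach_refl.
have [A' [B' [hinv' hsz r1 r2]]] := Phi_inv_step hinv hn.
have [|mu [hE r3 r4]] := IH A' B' _ hinv'; first exact: leq_trans hsz hm.
by exists mu; split=> //; [apply: reach_trans r1 r3 | apply: reach_trans r4 r2].
Qed.

(** Start the invariant with [A] empty. The reversed run reaches [Step1 la], where Psi stops for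
    lack of secondary parts. *)
Lemma Phi_terminates (la : seq (part n)) : in_O la ->
  exists mu, [/\ in_E mu, Phi_outputs la mu & Psi_outputs mu la].
Proof.
move=> hla; have [|mu [hE r1 r2]] := @Phi_inv_run [::] la.
  by split=> //; [case: (la) => // ? ? /=; rewrite take0 | left].
exists mu; split=> //; apply: reach_trans r2 _; apply: reach_step.
by rewrite Psi_stop; [apply: reach_refl | case/andP: hla].
Qed.

Lemma Phi_outputs_total_size (la : seq (part n)) mu :
  Phi_outputs la mu -> total_size mu = total_size la.
Proof.
case=> k; rewrite -[la]/(state_parts (Step1 la)) -[mu]/(state_parts (Stop mu)) => <-.
by elim: k => //= k <-; rewrite Phi_next_total.
Qed.

Lemma Phi_outputs_color_product (la : seq (part n)) mu :
  Phi_outputs la mu -> color_product mu = color_product la.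
Proof.
case=> k; rewrite -[la]/(state_parts (Step1 la)) -[mu]/(state_parts (Stop mu)) => <-.
by elim: k => //= k <-; rewrite Phi_next_color.
Qed.

(** * Phi as a function on partitions *)

Definition is_stop (st : state (part n)) : bool := if st is Stop _ then true else false.

Lemma Phi_stops (la : O_partition n) :
  exists k, is_stop (iter k (@Phi_next n) (Step1 (sval la))).
Proof.
by case: la => la hla; have [mu [_ [k hk] _]] := Phi_terminates hla; exists k; rewrite hk.
Qed.

(** [ex_minn] turns the mere existence of a stopping time into a definite number of steps. *)
Definition Phi_run (la : O_partition n) : seq (part n) :=
  state_parts (iter (ex_minn (Phi_stops la)) (@Phi_next n) (Step1 (sval la))).

Lemma Phi_run_outputs la : Phi_outputs (sval la) (Phi_run la).
Proof.
rewrite /Phi_run; case: ex_minnP => k hk _; exists k.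
by move: hk; case: (iter _ _ _).
Qed.

Lemma Phi_runP la : in_E (Phi_run la) /\ Psi_outputs (Phi_run la) (sval la).
Proof.
have [mu [hE h1 h2]] := Phi_terminates (svalP la).
by rewrite (Phi_outputs_fun (Phi_run_outputs la) h1).
Qed.

End Machines.

Theorem theorem4p1 (n : nat) :
  exists Phi : O_partition n -> E_partition n,
    [/\ forall la : O_partition n,
          [/\ Phi_outputs (sval la) (sval (Phi la)),
              total_size (sval (Phi la)) = total_size (sval la)
            & color_product (sval (Phi la)) = color_product (sval la)],
        injective Phi
      & forall la : O_partition n, Psi_outputs (sval (Phi la)) (sval la)].
Proof.
exists (fun la => exist _ (Phi_run la) (Phi_runP la).1).
split=> [la|la la' /(congr1 sval) /= e|la] /=; last exact: (Phi_runP la).2.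
  have h := Phi_run_outputs la; split=> //.
    exact: Phi_outputs_total_size.
  exact: Phi_outputs_color_product.
(* Equal outputs of Phi start the same run of Psi, which has a single output. *)
apply: val_inj; apply: Psi_outputs_fun (Phi_runP la).2 _.
by rewrite e; apply: (Phi_runP la').2.
Qed.
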